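(* Let $\varepsilon = 0.00008$ and let $t \ge 2$ be an integer. There exists $\Delta_0$ (which may depend on $t$) such that for every graph $G$ whose maximum degree $\Delta$ satisfies $\Delta \ge \Delta_0$, the distance-$t$ chromatic index of $G$ satisfies $\chi'_t(G) \le (2-\varepsilon)\Delta^t$.
   Context: Graphs are finite and have no loops or parallel edges. The distance between two distinct edges of a graph $G$ is the number of vertices in a shortest path between them (so adjacent edges have distance $1$); equivalently, it is their distance as vertices of the line graph $L(G)$. A distance-$t$ edge-colouring of $G$ is a colouring of the edges of $G$ such that no two distinct edges at distance at most $t$ receive the same colour. The distance-$t$ chromatic index $\chi'_t(G)$ is the least integer $k$ such that $G$ has a distance-$t$ edge-colouring using $k$ colours. Equivalently, $\chi'_t(G) = \chi((L(G))^t)$, where the $t$-th power $H^t$ of a graph $H$ has the vertex set of $H$ and two distinct vertices are adjacent in $H^t$ if and only if their distance in $H$ is at most $t$. *)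

(* Defs.v *)
From mathcomp Require Import all_boot all_order all_algebra.
Set Implicit Arguments.
Unset Strict Implicit.
Unset Printing Implicit Defensive.

Record sgraph := SGraph {
  vertex :> finType;
  adj : rel vertex;
  adj_sym : symmetric adj;
  adj_irr : irreflexive adj
}.

Section Graph.
Variable G : sgraph.

Definition degree (x : G) : nat := #|[set y : G | adj x y]|.

Definition max_degree : nat := \max_(x : G) degree x.

Definition edges : {set {set G}} :=
  [set A : {set G} | [exists x, exists y, adj x y && (A == [set x; y])]].

Definition edge : finType := {A : {set G} | A \in edges}.

(* The endpoints of the path lie in A and B; it may consist of one vertex,    *)
(* when that vertex is common to A and B.                                     *)
Definition path_between (A B : {set G}) (q : seq G) : bool :=
  if q is x :: s
  then [&& x \in A, path (@adj G) x s, uniq (x :: s) & last x s \in B]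
  else false.

(* The least number of vertices of a path between A and B, or None if there   *)
(* is no such path; a path has at most #|G| vertices.                         *)
Definition edge_dist (A B : edge) : option nat :=
  ohead [seq m <- iota 1 #|G| |
          [exists q : m.-tuple G, path_between (val A) (val B) q]].

Definition edge_dist_le (t : nat) (A B : edge) : bool :=
  if edge_dist A B is Some d then d <= t else false.

Definition is_edge_colouring (t k : nat) (c : {ffun edge -> 'I_k}) : bool :=
  [forall A : edge, forall B : edge,
    (A != B) && edge_dist_le t A B ==> (c A != c B)].

Definition edge_colourable (t k : nat) : bool :=
  [exists c : {ffun edge -> 'I_k}, is_edge_colouring t c].

Lemma edge_colourable_ex (t : nat) : exists k, edge_colourable t k.
Proof.
exists #|edge|; apply/existsP; exists [ffun A => enum_rank A].
apply/forallP=> A; apply/forallP=> B; apply/implyP=> /andP[neqAB _].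
by rewrite !ffunE (inj_eq enum_rank_inj).
Qed.

Definition chromatic_index (t : nat) : nat := ex_minn (edge_colourable_ex t).

End Graph.

(* Main.v *)
Require Import Defs.
From mathcomp Require Import all_boot all_order all_algebra.
From mathcomp Require Import ring lra zify.
Set Implicit Arguments.
Unset Strict Implicit.
Unset Printing Implicit Defensive.
Import Order.TTheory GRing.Theory Num.Theory.
Local Open Scope ring_scope.

(* Two edges e, f at distance at most t are joined by a walk with t vertices,
   starting at an end of e and finishing at an end of f; let N(e) be the set of
   the edges f so joined to e, and D = 2 Delta^t >= |N(e)|. Double counting
   shows that N(e) is far from a clique: at most 5/6 D^2 pairs of N(e)^2 are
   joined. Indeed, let u be a vertex, T the set of the ends of the walks of
   length t - 1 from u, and z a vertex outside T. The neighbours w of u that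
   reach z in t - 1 steps inject into the walks of length t from u to z, hence
   (up to multiplicities, which make T smaller) there are at most deg_T(z) of
   them, while at most Delta - deg_T(z) edges at z avoid T; an edge at z that
   avoids T is joined to uw only through such a w, and the product of the two
   counts is controlled by convexity.

   A graph of maximum degree less than D, in which the neighbourhoods of the
   vertices of large degree miss a constant proportion of the D^2 pairs, is
   coloured with (1 - 1/24000) D colours. For each colour a in a set of 3D/25
   colours, choose independently a random set of density 1/(6D), and give the
   colour a to its members that have no neighbour in it and were not chosen for
   an earlier colour. A vertex whose neighbourhood sees D/24000 colours twice
   can be coloured greedily afterwards. Exposing the colours one after the
   other, an exponential moment bounds the probability that a given vertex fails
   by an exponential in D, and the local lemma applies. *)

(** * Averages over finite product spaces, and the local lemma *)

Section Average.
Variable T : finType.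
Implicit Types f g : T -> rat.

(** Expectation under the uniform distribution; a probability is the average of an indicator, hence
    rational. *)
Definition avg f : rat := (\sum_x f x) / #|T|%:R.

Lemma eq_avg f g : f =1 g -> avg f = avg g.
Proof. by move=> fg; rewrite /avg; congr (_ / _); apply: eq_bigr. Qed.

Lemma ler_avg f g : (forall x, f x <= g x) -> avg f <= avg g.
Proof. by move=> fg; rewrite ler_wpM2r ?invr_ge0// ler_sum. Qed.

Lemma avg_ge0 f : (forall x, 0 <= f x) -> 0 <= avg f.
Proof. by move=> f0; rewrite mulr_ge0 ?invr_ge0// sumr_ge0. Qed.

Lemma avgD f g : avg (fun x => f x + g x) = avg f + avg g.
Proof. by rewrite /avg big_split mulrDl. Qed.

Lemma avgZ c f : avg (fun x => c * f x) = c * avg f.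
Proof. by rewrite /avg -mulr_sumr mulrA. Qed.

Lemma avg_sum (J : Type) (r : seq J) (P : pred J) (F : J -> T -> rat) :
  avg (fun x => \sum_(j <- r | P j) F j x) = \sum_(j <- r | P j) avg (F j).
Proof. by rewrite /avg exchange_big /= mulr_suml. Qed.

Lemma avg_cst c : (0 < #|T|)%N -> avg (fun=> c) = c.
Proof.
by move=> T0; rewrite /avg sumr_const -[c *+ _]mulr_natr mulfK ?pnatr_eq0 -?lt0n.
Qed.

End Average.

Section ProductSpace.
Variables (I : finType) (m : nat).
Notation Omega := {ffun I -> 'I_m.+1}.
Implicit Types (A : {set I}) (w : Omega).

Lemma card_space_gt0 : (0 < #|Omega|)%N.
Proof. by rewrite card_ffun expn_gt0 card_ord. Qed.

Definition splice A w w' : Omega := [ffun i => if i \in A then w i else w' i].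

(* (w, w') |-> (splice A w w', splice A w' w) is an involution, so two independent
   copies can be exchanged off A. *)
Lemma avg_splice A (f : Omega -> rat) :
  avg f = avg (fun w => avg (fun w' => f (splice A w w'))).
Proof.
have swap_inv : involutive
    (fun p : Omega * Omega => (splice A p.1 p.2, splice A p.2 p.1)).
  by case=> w w' /=; apply: f_equal2; apply/ffunP=> i; rewrite !ffunE; case: (i \in A).
have S0 : #|Omega|%:R != 0 :> rat by rewrite pnatr_eq0 -lt0n card_space_gt0.
rewrite /avg -mulr_suml pair_big /=.
rewrite [in RHS](reindex_inj (inv_inj swap_inv)) /=.
under [in RHS]eq_bigr => p _.
  have -> : splice A (splice A p.1 p.2) (splice A p.2 p.1) = p.1.
    by apply/ffunP=> i; rewrite !ffunE; case: (i \in A).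
  over.
rewrite -(pair_big predT predT (fun w _ => f w)) /=.
under [in RHS]eq_bigr do rewrite sumr_const -[f _ *+ _]mulr_natr.
by rewrite -mulr_suml mulfK.
Qed.

(** The hypotheses say that [f] reads only the coordinates in [A] and [g] only the others. *)
Lemma avg_indep A (f g : Omega -> rat) :
    (forall w w', f (splice A w w') = f w) ->
    (forall w w', g (splice A w w') = g w') ->
  avg (fun w => f w * g w) = avg f * avg g.
Proof.
move=> fA gA; rewrite (avg_splice A) mulrC -avgZ.
apply: eq_avg => w; rewrite mulrC -avgZ.
by apply: eq_avg => w'; rewrite fA gA.
Qed.

Lemma avg_prod (h : I -> 'I_m.+1 -> rat) :
  avg (fun w : Omega => \prod_i h i (w i)) = \prod_i avg (h i).
Proof.
rewrite /avg card_ffun -bigA_distr_bigA /= big_split /=; congr (_ * _).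
by rewrite prodr_const natrX exprVn.
Qed.

Lemma avg_eq0 : avg (fun t : 'I_m.+1 => (t == ord0)%:R) = m.+1%:R^-1.
Proof.
by rewrite /avg (bigD1 ord0)//= big1 ?addr0 ?card_ord ?mul1r// => i /negbTE->.
Qed.

Lemma avg_neq0 : avg (fun t : 'I_m.+1 => (t != ord0)%:R) = 1 - m.+1%:R^-1.
Proof.
apply/eqP; rewrite eq_sym subr_eq -avg_eq0 -avgD.
rewrite -[X in X == _](@avg_cst 'I_m.+1) ?card_ord//.
by apply/eqP/eq_avg => t; case: eqP => _ /=; rewrite ?add0r ?addr0.
Qed.

(** The indicator is a product of functions of single coordinates. As [C] may meet [A], at most
    [#|C|] coordinates have to be nonzero. *)
Lemma avg_pattern A (C : {set I}) :
  m.+1%:R^-1 ^+ #|A| * (1 - m.+1%:R^-1) ^+ #|C| <=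
  avg (fun w : Omega => ([forall i in A, w i == ord0] &&
                         [forall i in C :\: A, w i != ord0])%:R).
Proof.
pose h i (t : 'I_m.+1) : rat :=
  if i \in A then (t == ord0)%:R else
  if i \in C then (t != ord0)%:R else 1.
have p01 : 0 <= 1 - (m.+1%:R^-1 : rat) <= 1.
  by rewrite subr_ge0 invf_le1 ?ltr0n// ler1n /= gerBl invr_ge0.
rewrite (eq_avg (g := fun w => \prod_i h i (w i))); last first.
  move=> w; case: (boolP (_ && _)).
    move=> /andP[/forall_inP wA /forall_inP wC].
    rewrite big1// => i _; rewrite /h; case: ifP => iA; first by rewrite wA.
    by case: ifP => iC//; rewrite wC// inE iA.
  rewrite negb_and => /orP[] /forall_inPn[i].
    move=> iA wi; rewrite (bigD1 i)//= {1}/h iA (negbTE wi) mul0r//.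
  rewrite inE => /andP[/negbTE iA iC] wi.
  by rewrite (bigD1 i)//= {1}/h iA iC (negbTE wi) mul0r.
rewrite avg_prod (bigID (mem A)) /=.
rewrite (eq_bigr (fun=> m.+1%:R^-1)); last first.
  by move=> i iA; rewrite /h iA avg_eq0.
rewrite prodr_const ler_wpM2l ?exprn_ge0 ?invr_ge0//.
rewrite (bigID (mem C)) /=.
rewrite [X in _ <= _ * X]big1 ?mulr1; last first.
  by move=> i /andP[/negbTE iA /negbTE iC]; rewrite /h iA iC avg_cst ?card_ord.
rewrite (eq_bigr (fun=> 1 - m.+1%:R^-1)); last first.
  by move=> i /andP[/negbTE iA iC]; rewrite /h iA iC avg_neq0.
have /andP[p0 p1] := p01; rewrite prodr_const ler_wiXn2l//.
by apply: subset_leq_card; apply/subsetP=> i /andP[].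
Qed.

End ProductSpace.

(** * The symmetric local lemma *)

Section LocalLemma.
Variables (V I : finType) (m d : nat) (p : rat).
Notation Omega := {ffun I -> 'I_m.+1}.
Variables (bad : V -> pred Omega) (dom : V -> {set I}).

Hypothesis bad_dom : forall v (w w' : Omega),
  {in dom v, w =1 w'} -> bad v w = bad v w'.
Hypothesis bad_le : forall v, avg (fun w => (bad v w)%:R) <= p.
Hypothesis dom_deg : forall v, (#|[set u | ~~ [disjoint dom u & dom v]]| <= d)%N.
Hypothesis pd_le : 4 * p * d%:R <= 1.
Hypothesis p_ge0 : 0 <= p.

Let none (S : {set V}) (w : Omega) := [forall u in S, ~~ bad u w].
Let Pnone S := avg (fun w => (none S w)%:R).

(** The usual bound 2p on a conditional probability, multiplied out so that nothing is divided by a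
    probability that might vanish. *)
Lemma avg_bad_none n (S : {set V}) v : (#|S| < n)%N -> 
  avg (fun w => (bad v w && none S w)%:R) <= 2 * p * Pnone S.
Proof.
elim: n S v => // n IHn S v; rewrite ltnS => Sn.
pose G := [set u | ~~ [disjoint dom u & dom v]].
pose S1 := S :&: G; pose S2 := S :\: G.
(* Forget the events of [S1], which may share coordinates with [v]; those of [S2] are independent of
   [bad v]. *)
have S2S : avg (fun w => (bad v w && none S w)%:R) <= p * Pnone S2.
  apply: (@le_trans _ _ (avg (fun w => (bad v w)%:R * (none S2 w)%:R))).
    apply: ler_avg => w; rewrite -natrM mulnb ler_nat.
    case: (bad v w) => //=; case: (boolP (none S w)) => //= /forall_inP nS.
    rewrite lt0b; apply/forall_inP=> u.
    by rewrite inE => /andP[_ /nS].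
  rewrite (@avg_indep _ _ (dom v)).
  - by rewrite ler_wpM2r// avg_ge0.
  - move=> w w'; congr (_ %:R); congr nat_of_bool.
    by apply: bad_dom => i iv; rewrite ffunE iv.
  - move=> w w'; congr (_ %:R); congr nat_of_bool.
    apply: eq_forallb => u; case: (boolP (u \in S2)) => //=.
    rewrite !inE negbK => /andP[duv _]; congr negb.
    apply: bad_dom => i iu; rewrite ffunE ifN//.
    by apply: contraL duv => iv; apply/pred0Pn; exists i; rewrite /= iu iv.
apply: (le_trans S2S); rewrite [2 * p]mulrC -mulrA ler_wpM2l//.
have [S1_0|/set0Pn[u0 u0S1]] := eqVneq S1 set0.
  have -> : S2 = S by rewrite /S2 -[S in RHS](setID S G) -/S1 S1_0 set0U.
  by rewrite ler_peMl ?avg_ge0 ?ler1n.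
have S2n : (#|S2| < n)%N.
  apply: leq_trans Sn; apply: proper_card; rewrite properE subsetDl /=.
  move: u0S1; rewrite inE => /andP[u0S u0G].
  by apply/subsetPn; exists u0; rewrite // inE u0G.
(* A union bound over [S1], with the induction hypothesis for the smaller set [S2]. As 2p|S1| <=
   1/2, it gives Pnone S2 <= 2 Pnone S. *)
have step : Pnone S2 <= Pnone S + \sum_(u in S1) (2 * p * Pnone S2).
  apply: (@le_trans _ _ (Pnone S +
      \sum_(u in S1) avg (fun w => (bad u w && none S2 w)%:R))); last first.
    by rewrite lerD2l ler_sum// => u _; apply: IHn.
  rewrite -avg_sum -avgD; apply: ler_avg => w.
  case: (boolP (none S2 w)) => [n2|]; last by rewrite addr_ge0// sumr_ge0.
  case: (boolP (none S w)) => [n1|]; first by rewrite ler_wpDr// sumr_ge0.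
  case/forall_inPn=> u uS; rewrite negbK => bu.
  have uS1 : u \in S1.
    rewrite inE uS /=; apply/negPn/negP=> uG.
    by move/forall_inP: n2 => /(_ u); rewrite inE uG uS bu => /(_ isT).
  by rewrite (bigD1 u)//= bu /= add0r ler_wpDr// sumr_ge0.
have : \sum_(u in S1) (2 * p * Pnone S2) <= Pnone S2 / 2.
  rewrite sumr_const -mulr_natl.
  have : #|S1|%:R <= d%:R :> rat.
    rewrite ler_nat; apply: leq_trans (dom_deg v).
    by apply: subset_leq_card; apply: subsetIr.
  have : 0 <= Pnone S2 by apply: avg_ge0.
  move: pd_le p_ge0; set x : rat := #|S1|%:R; set y := Pnone S2.
  set e : rat := d%:R => h1 h2 h3 h4.
  have : p * x <= p * e by rewrite ler_wpM2l.
  move=> h5; have h6 : p * x <= 4^-1 by lra.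
  have : (p * x) * y <= 4^-1 * y by rewrite ler_wpM2r.
  lra.
lra.
Qed.

Lemma local_lemma : (0 < d)%N -> exists w, forall v, ~~ bad v w.
Proof.
move=> d0; have p4 : 4 * p <= 1.
  apply: le_trans pd_le; rewrite ler_peMr ?mulr_ge0 ?ler1n//.
(* Each event added to [S] keeps at least half of the probability, since 2p <= 1/2. *)
suff pos (n : nat) (S : {set V}) : (#|S| < n)%N -> 0 < Pnone S.
  have := pos _ setT (ltnSn _); rewrite ltNge => /negP nP.
  case: (boolP [exists w, none setT w]) => [/existsP[w /forall_inP nw]|].
    by exists w => v; apply: nw.
  move=> /existsPn nn; case: nP.
  rewrite /Pnone (eq_avg (g := fun=> 0)) ?avg_cst ?card_space_gt0// => w.
  by rewrite (negbTE (nn w)).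
elim: n S => // n IHn S; rewrite ltnS => Sn.
have [->|/set0Pn[v vS]] := eqVneq S set0.
  rewrite /Pnone (eq_avg (g := fun=> 1)) ?avg_cst ?card_space_gt0// => w.
  by have -> : none set0 w by apply/forall_inP=> u; rewrite inE.
have S'n : (#|S :\ v| < n)%N by rewrite (cardsD1 v S) vS in Sn.
have P'0 := IHn _ S'n.
have := avg_bad_none v S'n.
have : Pnone (S :\ v) <= Pnone S + avg (fun w => (bad v w && none (S :\ v) w)%:R).
  rewrite -avgD; apply: ler_avg => w.
  case: (boolP (none (S :\ v) w)) => [n2|_]; last by rewrite addr_ge0.
  case: (boolP (bad v w)) => [bv|nbv]; first by rewrite /= lerDr.
  suff -> : none S w by rewrite /= addr0.
  apply/forall_inP=> u uS; have [->//|uv] := eqVneq u v.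
  by move/forall_inP: n2; apply; rewrite !inE uv uS.
have : p * Pnone (S :\ v) <= 4^-1 * Pnone (S :\ v) by rewrite ler_wpM2r ?(ltW P'0)//; lra.
move: P'0; set y := Pnone _; lra.
Qed.

End LocalLemma.

(** * Colouring locally sparse graphs *)

(** Colouring a blank vertex preserves the last hypothesis: a neighbour of it sees at most one more
    colour and one blank vertex less. As [nb] is reflexive, a blank vertex counts itself, which
    leaves it a free colour. *)
Lemma greedy_extension (V : finType) (nb : rel V) (q : nat)
    (c : {ffun V -> option 'I_q}) :
    reflexive nb -> symmetric nb ->
    (forall u v a, nb u v -> c u = Some a -> c v = Some a -> u = v) ->
    (forall v, c v = None ->
      (#|[set a | [exists u, nb v u && (c u == Some a)]]| +
       #|[set u | nb v u && (c u == None)]| <= q)%N) ->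
  exists c' : V -> 'I_q, forall u v, nb u v -> u != v -> c' u != c' v.
Proof.
move=> nbxx nbC.
have [n] := ubnP #|[set u | c u == None]|; elim: n c => // n IHn c.
rewrite ltnS => cn c_proper c_room.
have [blank0|[v]] := set_0Vmem [set u | c u == None].
  have /fin_all_exists[c' c'E] u : exists a, c u = Some a.
    case E: (c u) => [a|]; first by exists a.
    by move/setP/(_ u): blank0; rewrite !inE E.
  exists c' => u v uv; apply: contra => /eqP cuv; apply/eqP.
  by apply: (c_proper u v (c' u)); rewrite // c'E // cuv.
rewrite inE => /eqP cv.
set A := fun x => [set a | [exists u, nb x u && (c u == Some a)]] in c_room *.
set B := fun x => [set u | nb x u && (c u == None)] in c_room *.
have [a aA] : exists a, a \notin A v.
  have Av : (#|A v| < q)%N.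
    apply: leq_trans (c_room v cv); rewrite -addn1 leq_add2l card_gt0.
    by apply/set0Pn; exists v; rewrite inE nbxx cv eqxx.
  have : (0 < #|~: A v|)%N by rewrite cardsCs setCK card_ord subn_gt0.
  by move/card_gt0P => [a]; rewrite inE => aA; exists a.
pose c1 := [ffun u => if u == v then Some a else c u].
apply: (IHn c1).
- apply: leq_trans cn; apply: proper_card; apply/properP; split.
    by apply/subsetP=> u; rewrite !inE ffunE; case: ifP.
  by exists v; rewrite inE ?cv// ffunE eqxx.
- have aP u b : nb u v -> Some a = Some b -> c u = Some b -> u = v.
    move=> uv [<-] cu; case/negP: aA; rewrite inE.
    by apply/existsP; exists u; rewrite nbC uv cu eqxx.
  move=> x y b; rewrite !ffunE; case: eqP => [->|_]; case: eqP => [->|_] //.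
  + by move=> vy ab cy; apply/esym/(aP y b); rewrite // nbC.
  + by move=> xv cx ab; apply: (aP x b).
  + exact: c_proper.
- move=> x; rewrite ffunE; case: eqP => // xv cx.
  apply: leq_trans (c_room x cx); have [xnv|xnv] := boolP (nb x v).
    rewrite [X in (_ <= _ + X)%N](cardsD1 v) inE xnv cv eqxx addnA addn1.
    apply: leq_add.
      apply: (@leq_trans #|a |: A x|); last by rewrite cardsU1; case: (_ \notin _).
      apply: subset_leq_card; apply/subsetP=> b; rewrite !inE.
      case/existsP=> u; rewrite ffunE; case: (u =P v) => [_|_] /andP[xu].
        by move/eqP=> [<-]; rewrite eqxx.
      by move=> cu; apply/orP; right; apply/existsP; exists u; rewrite xu.
    apply: subset_leq_card; apply/subsetP=> u; rewrite !inE ffunE.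
    by case: (u =P v); rewrite ?andbF.
  apply: leq_add; apply: subset_leq_card; apply/subsetP=> u; rewrite !inE.
    case/existsP=> y; rewrite ffunE; case: (y =P v) => [->|_] /andP[xy cy].
      by rewrite xy in xnv.
    by apply/existsP; exists y; rewrite xy.
  by rewrite ffunE; case: (u =P v); rewrite ?andbF.
Qed.

(** * The random partial colouring *)

Section RandomColouring.
Variables (V : finType) (nb : rel V) (k m : nat).
Hypotheses (nbxx : reflexive nb) (nbC : symmetric nb).
Notation Omega := {ffun V * 'I_k -> 'I_m.+1}.
Implicit Types (w : Omega) (a : 'I_k) (u v y : V).

(** Membership of [u] in the random set of colour [a], of probability 1/(m+1). *)
Definition hit w a u := w (u, a) == ord0.
Definition touched w (j : nat) u := [exists a : 'I_k, (a < j)%N && hit w a u].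
Definition kept w a u :=
  [&& hit w a u, ~~ touched w a u & [forall y, nb u y && (y != u) ==> ~~ hit w a y]].
Definition saved w v a :=
  [exists u, exists y, [&& u != y, nb v u, nb v y, kept w a u & kept w a y]].
Definition savings w v := #|[set a | saved w v a]|.

Lemma kept_inj w a b u : kept w a u -> kept w b u -> a = b.
Proof.
move=> /and3P[ha na _] /and3P[hb nb' _]; apply/val_inj/eqP; rewrite eqn_leq.
rewrite (leqNgt a) (leqNgt b); apply/andP; split.
  by apply: contra na => ab; apply/existsP; exists b; rewrite ab.
by apply: contra nb' => ab; apply/existsP; exists a; rewrite ab.
Qed.

Lemma kept_indep w a u y : nb u y -> kept w a u -> kept w a y -> u = y.
Proof.
move=> uy /and3P[_ _ /forallP/(_ y)]; rewrite uy /= => yu /and3P[hy _ _].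
by apply/eqP; rewrite eq_sym; apply: contraLR yu => ->; rewrite /= hy.
Qed.

(** A saved colour is seen once but occupies two neighbours, so it leaves one more colour to the
    greedy extension. Neighbourhoods of at most [q] vertices have room anyway. *)
Lemma savings_colouring w (q D : nat) :
    (k <= q)%N -> (forall v, #|[set u | nb v u]| <= D)%N ->
    (forall v, q < #|[set u | nb v u]| -> D <= q + savings w v)%N ->
  exists c : V -> 'I_q, forall u v, nb u v -> u != v -> c u != c v.
Proof.
move=> kq degD room.
pose c := [ffun u => omap (widen_ord kq) [pick a | kept w a u]].
have c_kept a u : kept w a u -> c u = Some (widen_ord kq a).
  move=> kau; rewrite ffunE; case: pickP => [b kbu|/(_ a)]; last by rewrite kau.
  by rewrite (kept_inj kau kbu).
have kept_c b u : c u = Some b -> exists2 a, b = widen_ord kq a & kept w a u.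
  by rewrite ffunE; case: pickP => //= a kau [<-]; exists a.
apply: (@greedy_extension V nb q c) => //.
  move=> u v b uv /kept_c[a -> kau] /kept_c[a' /(congr1 val) /= aa' kav].
  by apply: (kept_indep uv kau); rewrite (val_inj aa').
move=> v cv; set X := [set b | _]; set B := [set u | _].
pose Y := [set widen_ord kq a | a in [set a | saved w v a]].
have cY : #|Y| = savings w v.
  by rewrite card_imset// => a b /(congr1 val) /= /val_inj.
suff H : (#|X| + #|Y| + #|B| <= #|[set u | nb v u]|)%N.
  have := room v; have := degD v; rewrite -cY.
  by case: (leqP #|[set u | nb v u]| q) => [|_ ? /(_ isT)]; lia.
(* Sort the neighbours by colour: a seen colour has at least one of them, a saved colour at least
   two. *)
have -> : #|[set u | nb v u]| =
    (\sum_(b : 'I_q) #|[set u | nb v u && (c u == Some b)]| + #|B|)%N.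
  rewrite -(cardsID B) addnC; congr (_ + _)%N; last first.
    by apply: eq_card => u; rewrite !inE andbA andbb.
  rewrite -sum1_card; under [RHS]eq_bigr do rewrite -sum1_card big_mkcond.
  rewrite big_mkcond exchange_big; apply: eq_bigr => u _ /=.
  under eq_bigr do rewrite inE.
  rewrite !inE; case: (nb v u); last by rewrite big1 // andbF.
  case: (c u) => [b|] /=; last by rewrite big1.
  by rewrite (bigD1 b)//= eqxx big1 ?addn0// => b' /negbTE; rewrite eq_sym => b'b;
    rewrite (inj_eq Some_inj) b'b.
rewrite leq_add2r -!sum1_card [X in (X + _ <= _)%N]big_mkcond.
rewrite [X in (_ + X <= _)%N]big_mkcond -big_split /=; apply: leq_sum => b _.
case: (boolP (b \in Y)) => [/imsetP[a]|_].
  rewrite inE => /existsP[u /existsP[y /and5P[uy vu vy kau kay]]] ->.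
  apply: (@leq_trans 2); first by case: ifP.
  apply/card_gt1P; exists u, y; split=> //; rewrite !inE ?vu ?vy /=.
    by rewrite (c_kept _ _ kau).
  by rewrite (c_kept _ _ kay).
rewrite addn0; case: ifP => //; rewrite inE => /existsP[u /andP[vu cu]].
by apply/card_gt0P; exists u; rewrite inE vu cu.
Qed.

Lemma touched_ext w w' (j : nat) u :
  (forall a : 'I_k, (a < j)%N -> hit w a u = hit w' a u) ->
  touched w j u = touched w' j u.
Proof.
by move=> e; apply: eq_existsb => a; case: (boolP (a < j)%N) => //= /e->.
Qed.

Lemma kept_ext w w' a u :
    (forall (b : 'I_k) y, nb u y -> (b <= a)%N -> hit w b y = hit w' b y) ->
  kept w a u = kept w' a u.
Proof.
move=> e; rewrite /kept e //; congr [&& _, ~~ _ & _].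
  by apply: touched_ext => b /ltnW; apply: e.
by apply: eq_forallb => y; case: (boolP (nb u y)) => //= uy; rewrite e.
Qed.

Lemma saved_ext w w' v a :
    (forall (b : 'I_k) x y, nb v x -> nb x y -> (b <= a)%N -> hit w b y = hit w' b y) ->
  saved w v a = saved w' v a.
Proof.
move=> e; apply: eq_existsb => u; apply: eq_existsb => y.
case: (u != y) => //=; case: (boolP (nb v u)) => //= vu.
case: (boolP (nb v y)) => //= vy; congr (_ && _).
  by apply: kept_ext => b x; apply: e.
by apply: kept_ext => b x; apply: e.
Qed.

Definition tcount w v (j : nat) := #|[set u | nb v u && touched w j u]|.

Lemma tcount_le w v j j' : (j <= j')%N -> (tcount w v j <= tcount w v j')%N.
Proof.
move=> jj; apply: subset_leq_card; apply/subsetP=> u; rewrite !inE.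
move=> /andP[-> /existsP[a /andP[aj ha]]]; apply/existsP; exists a.
by rewrite ha (leq_trans aj).
Qed.

(** Markov's inequality for 2 to the number of hits in the neighbourhood: hits are independent, and
    each contributes a factor of mean 1 + 1/(m+1). *)
Lemma touched_tail v (T D : nat) : (#|[set u | nb v u]| <= D)%N ->
  avg (fun w => (T < tcount w v k)%:R) <=
  (1 + m.+1%:R^-1) ^+ (D * k) / 2 ^+ T.
Proof.
move=> degD; rewrite ler_pdivlMr ?exprn_gt0// mulrC -avgZ.
pose h (i : V * 'I_k) (t : 'I_m.+1) : rat :=
  if nb v i.1 && (t == ord0) then 2 else 1.
apply: (@le_trans _ _ (avg (fun w : Omega => \prod_i h i (w i)))).
  apply: ler_avg => w; rewrite /h -big_mkcond prodr_const /=.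
  case: (ltnP T) => [Tt|_]; last by rewrite mulr0 exprn_ge0.
  rewrite mulr1 ler_weXn2l ?ler1n//; apply: leq_trans (ltnW Tt) _.
  apply: (@leq_trans #|[set i.1 | i in [pred i | nb v i.1 && (w i == ord0)]]|).
    apply: subset_leq_card; apply/subsetP=> u; rewrite inE.
    move=> /andP[vu /existsP[a /andP[_ ha]]]; apply/imsetP; exists (u, a) => //.
    by rewrite inE vu.
  by rewrite (leq_trans (leq_imset_card _ _)).
have p1 : 1 <= 1 + m.+1%:R^-1 :> rat by rewrite lerDl invr_ge0.
rewrite avg_prod (bigID (fun i => nb v i.1)) /=.
rewrite [X in _ * X]big1 ?mulr1; last first.
  by move=> i /negbTE vi; rewrite /h vi avg_cst ?card_ord.
rewrite (eq_bigr (fun=> 1 + m.+1%:R^-1)); last first.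
  move=> i vi; rewrite /h vi -avg_eq0 -[X in _ = X + _](@avg_cst 'I_m.+1) ?card_ord//.
  by rewrite -avgD; apply: eq_avg => t /=; case: eqP => _ /=; rewrite ?addr0.
rewrite prodr_const ler_weXn2l//.
have -> : #|[pred i : V * 'I_k | nb v i.1]| = #|setX [set u | nb v u] [set: 'I_k]|.
  by apply: eq_card => -[u a]; rewrite !inE andbT.
by rewrite cardsX cardsT card_ord leq_mul2r degD orbT.
Qed.

(** In [splice (past a) w w'] the colours before [a] come from [w], the others from [w']; averaging
    over [w'] is conditioning on the past. *)
Definition past (j : nat) : {set V * 'I_k} := [set i : V * 'I_k | (i.2 < j)%N].

Lemma hit_splice_past (j : nat) w w' a u : (a < j)%N ->
  hit (splice (past j) w w') a u = hit w a u.
Proof. by move=> aj; rewrite /hit ffunE inE aj. Qed.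

Lemma hit_splice_now w w' a u : hit (splice (past a) w w') a u = hit w' a u.
Proof. by rewrite /hit ffunE inE ltnn. Qed.

Lemma touched_splice j w w' u :
  touched (splice (past j) w w') j u = touched w j u.
Proof. by apply: touched_ext => a aj; rewrite hit_splice_past. Qed.


Lemma bernoulli_le (F : realFieldType) (x : F) n :
  0 <= x <= 1 -> 1 - n%:R * x <= (1 - x) ^+ n.
Proof.
move=> /andP[x0 x1]; elim: n => [|n IHn]; first by rewrite mul0r subr0 expr0.
rewrite exprSr -natr1; have : (1 - n%:R * x) * (1 - x) <= (1 - x) ^+ n * (1 - x).
  by rewrite ler_wpM2r// subr_ge0.
apply: le_trans; have : 0 <= n%:R * (x * x) by rewrite mulr_ge0 ?mulr_ge0.
lra.
Qed.

(* Colour a is saved as soon as, among v, two untouched non-adjacent neighbours of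
   v, and all their neighbours, it hits exactly these two; a given outcome has this
   property for at most two ordered pairs, whence the factor 2. *)
Lemma saved_prob w v a (D P : nat) : (3 * D <= m.+1)%N ->
    (forall v, #|[set u | nb v u]| <= D)%N ->
    (P <= #|[set p | [&& nb v p.1, nb v p.2 & ~~ nb p.1 p.2]]|)%N ->
  (P%:R - 2 * D%:R * (tcount w v a)%:R) * (1 - 3 * D%:R / m.+1%:R) / m.+1%:R ^+ 2
    <= 2 * avg (fun w' => (saved (splice (past a) w w') v a)%:R).
Proof.
move=> DM degD degP.
pose Q := [set p : V * V | [&& nb v p.1, nb v p.2, ~~ nb p.1 p.2,
  ~~ touched w a p.1 & ~~ touched w a p.2]].
(* Each touched neighbour spoils at most [D] pairs as first entry and [D] as second. *)
have cQ : P%:R - 2 * D%:R * (tcount w v a)%:R <= #|Q|%:R :> rat.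
  rewrite lerBlDr -!natrM -natrD ler_nat; apply: leq_trans degP _.
  pose N := [set u | nb v u]; pose Tc := [set u | nb v u && touched w a u].
  apply: (@leq_trans #|Q :|: (setX Tc N :|: setX N Tc)|).
    apply: subset_leq_card; apply/subsetP=> -[x y]; rewrite !inE /=.
    move=> /and3P[-> -> ->] /=; case: (touched w a x); rewrite //= ?orbT//.
    by case: (touched w a y).
  rewrite (leq_trans (leq_card_setU _ _))// leq_add2l.
  rewrite (leq_trans (leq_card_setU _ _))// !cardsX -mulnA mul2n -addnn.
  by rewrite [X in (X + _ <= _)%N]mulnC leq_add ?leq_mul2r ?degD ?orbT.
pose A (p : V * V) : {set V * 'I_k} := [set (p.1, a); (p.2, a)].
pose C (p : V * V) : {set V * 'I_k} :=
  setX ([set u | nb v u] :|: ([set u | nb p.1 u] :|: [set u | nb p.2 u])) [set a].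
pose F p (w' : {ffun V * 'I_k -> 'I_m.+1}) :=
  [forall i in A p, w' i == ord0] && [forall i in C p :\: A p, w' i != ord0].
have M1 : 0 <= (m.+1%:R^-1 : rat) <= 1.
  by rewrite invr_ge0 ler0n invf_le1 ?ltr0n// ler1n.
have FP p : p \in Q ->
    (1 - 3 * D%:R / m.+1%:R) / m.+1%:R ^+ 2 <= avg (fun w' => (F p w')%:R).
  rewrite inE => /and5P[_ _ np _ _]; apply: le_trans (avg_pattern _ _ _).
  have p12 : p.1 != p.2 by apply: contraNneq np => ->; rewrite nbxx.
  rewrite cards2 (inj_eq (can_inj (fun x : V => erefl (x, a).1))) p12.
  rewrite mulrC exprVn ler_wpM2l ?invr_ge0 ?exprn_ge0//.
  have cC : (#|C p| <= 3 * D)%N.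
    rewrite cardsX cards1 muln1 (leq_trans (leq_card_setU _ _))//.
    rewrite (leq_trans (leq_add (degD _) (leq_card_setU _ _)))//.
    by rewrite !mulSn mul0n addn0 !leq_add.
  have := bernoulli_le #|C p| M1; apply: le_trans.
  rewrite lerD2l lerN2 ler_wpM2r ?invr_ge0// -natrM ler_nat//.
have hitF p w' : F p w' -> (hit w' a p.1 /\ hit w' a p.2) /\
    forall u, nb v u || nb p.1 u || nb p.2 u -> hit w' a u -> u = p.1 \/ u = p.2.
  move=> /andP[/forall_inP FA /forall_inP FC]; split.
    by split; apply: FA; rewrite !inE eqxx ?orbT.
  move=> u uC hu; have := FC (u, a); rewrite !inE /= eqxx andbT orbA uC andbT.
  rewrite (negbTE (_ : ~~ (w' (u, a) != ord0))) ?negbK//.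
  rewrite !xpair_eqE eqxx !andbT; case: eqP => [->|_]; first by left.
  by case: eqP => [->|_]; [right | move=> /(_ isT)].
have sumF (w' : {ffun V * 'I_k -> 'I_m.+1}) :
    \sum_(p in Q) (F p w')%:R <= 2 * (saved (splice (past a) w w') v a)%:R :> rat.
  have [/existsP[p0 /andP[p0Q Fp0]]|/existsPn nF] :=
      boolP [exists p, (p \in Q) && F p w']; last first.
    rewrite big1 ?mulr_ge0// => p pQ; move: (nF p); rewrite pQ /=.
    by move=> /negbTE->.
  have [[h1 h2] h3] := hitF _ _ Fp0.
  move: (p0Q); rewrite inE => /and5P[v1 v2 n12 t1 t2].
  have p12 : p0.1 != p0.2 by apply: contraNneq n12 => ->; rewrite nbxx.
  have -> : saved (splice (past a) w w') v a.
    apply/existsP; exists p0.1; apply/existsP; exists p0.2.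
    rewrite p12 v1 v2 /kept !hit_splice_now h1 h2 !touched_splice t1 t2 /=.
    apply/andP; split; apply/forallP=> y; apply/implyP=> /andP[py yp];
      rewrite hit_splice_now; apply: contra yp => hy;
      have [] := h3 y _ hy; rewrite ?py ?orbT// => E; move: py;
      rewrite E ?(negbTE n12)// nbC (negbTE n12)//.
  rewrite mulr1 -natr_sum ler_nat.
  apply: (@leq_trans #|[set p0; (p0.2, p0.1)]|); last by rewrite cards2; case: (_ == _).
  rewrite -sum1_card big_mkcond [X in (_ <= X)%N]big_mkcond /=.
  apply: leq_sum => p _; case: ifP => // pQ; case: (boolP (F p w')) => //= Fp.
  have [[k1 k2] _] := hitF _ _ Fp.
  move: (pQ); rewrite inE => /and5P[w1 w2 m12 _ _].
  have e12 : p.1 != p.2 by apply: contraNneq m12 => ->; rewrite nbxx.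
  suff -> : p \in [set p0; (p0.2, p0.1)] by [].
  have := h3 p.1; rewrite w1 => /(_ isT k1) E1.
  have := h3 p.2; rewrite w2 => /(_ isT k2) E2.
  rewrite !inE [p]surjective_pairing [p0]surjective_pairing /=.
  case: E1 E2 => E1 [] E2; rewrite E1 E2 ?eqxx ?orbT//.
    by rewrite E1 E2 eqxx in e12.
  by rewrite E1 E2 eqxx in e12.
rewrite -avgZ.
apply: (@le_trans _ _ (avg (fun w' => \sum_(p in Q) (F p w')%:R))); last first.
  exact: ler_avg.
rewrite avg_sum; apply: le_trans (ler_sum (P := mem Q) _ FP).
rewrite sumr_const -[leLHS]mulrA -[leRHS]mulr_natl ler_wpM2r//.
rewrite mulr_ge0 ?invr_ge0 ?exprn_ge0// subr_ge0 ler_pdivrMr ?ltr0n//.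
by rewrite mul1r -natrM ler_nat.
Qed.

(* Declaring the colours saved once more than T neighbours are touched makes the
   conditional lower bound on this event valid for every past. *)
Definition saved_or_full (T : nat) w v a := (T < tcount w v a)%N || saved w v a.

(** Colours are exposed in order: given the past, the earlier factors are constant and the next one
    has mean at most 1 - (1 - z)p. *)
Lemma saved_or_full_moment v (T : nat) (z p : rat) :
    0 <= z <= 1 ->
    (forall w a, p <= avg (fun w' => (saved_or_full T (splice (past a) w w') v a)%:R)) ->
  avg (fun w => \prod_a (if saved_or_full T w v a then z else 1)) <=
    (1 - (1 - z) * p) ^+ k.
Proof.
move=> /andP[z0 z1] pP.
pose G j w := \prod_(a < k | (a < j)%N) (if saved_or_full T w v a then z else 1).
have G0 j w' : 0 <= G j w' by apply: prodr_ge0 => a _; case: ifP.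
suff H j : (j <= k)%N -> avg (G j) <= (1 - (1 - z) * p) ^+ j.
  apply: le_trans (H k (leqnn k)); apply/ler_avg => w'.
  by rewrite /G [leRHS](eq_bigl xpredT)// => a; rewrite ltn_ord.
elim: j => [_|j IHj jk].
  rewrite (eq_avg (g := fun=> 1)) ?avg_cst ?card_space_gt0// => w'.
  by rewrite /G big_pred0.
pose a := Ordinal jk.
have GS w' : G j.+1 w' = G j w' * (1 - (1 - z) * (saved_or_full T w' v a)%:R).
  rewrite /G (bigD1 a) ?ltnSn//= mulrC; congr (_ * _).
    apply: eq_bigl => b; rewrite ltnS leq_eqVlt -(inj_eq val_inj) /=.
    by case: ltngtP.
  by case: ifP => _; rewrite ?mulr1 ?mulr0 ?subr0// opprB addrC subrK.
rewrite (avg_splice (past j)).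
have Gpast w1 w2 : G j (splice (past j) w1 w2) = G j w1.
  apply: eq_bigr => b bj; congr (if _ then _ else _).
  rewrite /saved_or_full; congr (_ || _).
    rewrite /tcount; congr (_ < _)%N; apply: eq_card => u; rewrite !inE.
    congr (_ && _); apply: touched_ext => c cb.
    by rewrite hit_splice_past// (ltn_trans cb).
  by apply: saved_ext => c x y _ _ cb; rewrite hit_splice_past// (leq_ltn_trans cb).
apply: (@le_trans _ _ (avg (fun w1 => (1 - (1 - z) * p) * G j w1))).
  apply: ler_avg => w1.
  rewrite (eq_avg (g := fun w2 => G j w1 *
      (1 + - (1 - z) * (saved_or_full T (splice (past j) w1 w2) v a)%:R))); last first.
    by move=> w2; rewrite GS Gpast mulNr.
  rewrite avgZ mulrC ler_wpM2r// avgD avgZ avg_cst ?card_space_gt0//.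
  by rewrite mulNr lerD2l lerN2 ler_wpM2l ?subr_ge0// (pP w1 a).
(* This makes 1 - (1 - z)p nonnegative, so that the induction hypothesis can be multiplied by it. *)
have p1 : p <= 1.
  apply: le_trans (pP [ffun=> ord0] a) _.
  rewrite -[leRHS](@avg_cst {ffun V * 'I_k -> 'I_m.+1}) ?card_space_gt0//.
  by apply: ler_avg => w1; case: (saved_or_full _ _ _ _).
rewrite avgZ exprS ler_wpM2l ?IHj ?(ltnW jk)//.
have : (1 - z) * p <= (1 - z) * 1 by rewrite ler_wpM2l// subr_ge0.
by move: z0; lra.
Qed.

(** If at most [T] neighbours are ever touched, the product in [saved_or_full_moment] is
    [z ^+ savings w v], and Markov's inequality gives the second term. The first term covers the
    other case. *)
Lemma savings_tail v (T D s : nat) (z p : rat) :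
    0 < z <= 1 -> p <= 1 -> (#|[set u | nb v u]| <= D)%N ->
    (forall w a, (tcount w v a <= T)%N ->
      p <= avg (fun w' => (saved (splice (past a) w w') v a)%:R)) ->
  avg (fun w => (savings w v < s)%N%:R) <=
    (1 + m.+1%:R^-1) ^+ (D * k) / 2 ^+ T + (1 - (1 - z) * p) ^+ k / z ^+ s.
Proof.
move=> /andP[z0 z1] p1 degD pP.
apply: le_trans (lerD (touched_tail T degD) (lexx _)).
have zs : 0 < z ^+ s by rewrite exprn_gt0.
have := @saved_or_full_moment v T z p; rewrite (ltW z0) z1 => /(_ isT).
have pP' w a : p <= avg (fun w' => (saved_or_full T (splice (past a) w w') v a)%:R).
  case: (leqP (tcount w v a) T) => Tw.
    by apply: le_trans (pP _ _ Tw) _; apply: ler_avg => w';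
      rewrite ler_nat /saved_or_full; case: (saved _ _ _); rewrite ?orbT.
  apply: le_trans p1 _; rewrite -[leLHS](@avg_cst {ffun V * 'I_k -> 'I_m.+1}) ?card_space_gt0//.
  apply: ler_avg => w'; rewrite /saved_or_full ler1n lt0b.
  rewrite (_ : tcount _ v a = tcount w v a) ?Tw//.
  by apply: eq_card => u; rewrite !inE touched_splice.
move=> /(_ pP') mom; rewrite mulrC.
apply: le_trans (lerD (lexx _) (ler_wpM2l _ mom)); last by rewrite invr_ge0 ltW.
rewrite -avgZ -avgD; apply: ler_avg => w.
have F0 : 0 <= \prod_a (if saved_or_full T w v a then z else 1).
  by apply: prodr_ge0 => a _; case: ifP => // _; apply: ltW.
case: (leqP (tcount w v k) T) => Tw; last first.
  apply: (@le_trans _ _ 1); first by case: (_ < _)%N.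
  by rewrite lerDl mulr_ge0// invr_ge0 ltW.
case: ltnP => ls; last by rewrite addr_ge0// mulr_ge0// invr_ge0 ltW.
have -> : \prod_a (if saved_or_full T w v a then z else 1) = z ^+ savings w v.
  rewrite -big_mkcond prodr_const; congr (_ ^+ _); apply: eq_card => a.
  rewrite !inE /saved_or_full unfold_in ltnNge (leq_trans _ Tw)//.
  by rewrite tcount_le// ltnW.
by rewrite add0r ler_pdivlMl// mulr1; apply: ler_wiXn2l; rewrite ?(ltW z0) ?(ltnW ls).
Qed.

End RandomColouring.

(** * Union bounds and estimates of powers *)

Lemma card_bigcup_sum (V W : finType) (A : {pred V}) (F : V -> {set W}) :
  (#|\bigcup_(x in A) F x| <= \sum_(x in A) #|F x|)%N.
Proof.
elim/big_rec2: _ => [|x n B _ Bn]; first by rewrite cards0.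
by rewrite (leq_trans (leq_card_setU _ _))// leq_add2l.
Qed.

Lemma card_bigcup_le (V W : finType) (A : {set V}) (F : V -> {set W}) (D : nat) :
  (forall x, #|F x| <= D)%N -> (#|\bigcup_(x in A) F x| <= #|A| * D)%N.
Proof.
move=> FD; apply: leq_trans (card_bigcup_sum _ _) _.
by rewrite -sum_nat_const leq_sum.
Qed.

(** Multiply by (1 - x)^n: the product is at most 1, while (1 - x)^n >= 2/3 by Bernoulli. *)
Lemma expr1D_le (F : realFieldType) (x : F) n : 0 <= x -> n%:R * x <= 1 / 3 -> (1 + x) ^+ n <= 3 / 2.
Proof.
move=> x0; case: n => [|n nx]; first by rewrite expr0; lra.
have x1 : x <= 1 / 3 by apply: le_trans nx; rewrite ler_peMl// ler1n.
have : 1 - n.+1%:R * x <= (1 - x) ^+ n.+1 by apply: bernoulli_le; lra.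
have : ((1 + x) * (1 - x)) ^+ n.+1 <= 1.
  by apply: exprn_ile1; nra.
rewrite exprMn; have : 0 <= (1 + x) ^+ n.+1 by apply: exprn_ge0; lra.
set a := (1 + x) ^+ n.+1; set b := (1 - x) ^+ _ => a0 ab b1.
have : a * (2 / 3) <= a * b by apply: ler_wpM2l => //; lra.
lra.
Qed.

(** Dually, (1 + x)^n >= 2 and (1 + x)^n (1 - x)^n <= 1. *)
Lemma expr1B_le (F : realFieldType) (x : F) n : 0 <= x <= 1 -> 1 <= n%:R * x -> (1 - x) ^+ n <= 1 / 2.
Proof.
move=> /andP[x0 x1] nx.
have H k : 1 + k%:R * x <= (1 + x) ^+ k.
  elim: k => [|k IHk]; first by rewrite mul0r addr0 expr0.
  rewrite exprSr -natr1; have : (1 + k%:R * x) * (1 + x) <= (1 + x) ^+ k * (1 + x).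
    by rewrite ler_wpM2r// addr_ge0.
  have : 0 <= k%:R * (x * x) by rewrite !mulr_ge0.
  lra.
have : ((1 + x) * (1 - x)) ^+ n <= 1 by apply: exprn_ile1; nra.
rewrite exprMn; have : 0 <= (1 - x) ^+ n by apply: exprn_ge0; lra.
have := H n; set a := (1 + x) ^+ n; set b := (1 - x) ^+ _ => ha b0 ab.
have : 2 * b <= a * b by apply: ler_wpM2r => //; lra.
lra.
Qed.

(** With h = 1 - r one has r(1 + h) <= 1, and d + 1 blocks of length j in the exponent give (1 +
    h)^n >= (jh)^(d+1), of degree above d. *)
Lemma poly_geometric (C r : rat) (d : nat) : 0 <= C -> 0 <= r < 1 ->
  exists n0, forall n, (n0 <= n)%N -> C * n%:R ^+ d * r ^+ n <= 1.
Proof.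
move=> C0 /andP[r0 r1]; pose h := 1 - r.
have h0 : 0 < h by rewrite subr_gt0.
(* Chosen so that C (2(d+1)j)^d = K j^d h^(d+1), which is at most (jh)^(d+1) once K <= j. *)
pose K := C * (2 * d.+1%:R) ^+ d / h ^+ d.+1.
have K0 : 0 <= K.
  apply: divr_ge0; last by rewrite exprn_ge0 ?(ltW h0).
  by rewrite mulr_ge0// exprn_ge0// mulr_ge0.
exists (d.+1 * (Num.bound K).+1)%N => n nK.
pose j := (n %/ d.+1)%N.
have Kj : K <= j%:R.
  apply: (@le_trans _ _ (Num.bound K)%:R); first exact: ltW (archi_boundP K0).
  by rewrite ler_nat /j leq_divRL// (leq_trans _ nK)// mulnC leq_mul2l leqnSn orbT.
have j0 : (0 < j)%N by rewrite divn_gt0// (leq_trans _ nK)// leq_pmulr.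
have nj : (n <= 2 * d.+1 * j)%N.
  have := divn_eq n d.+1; have := ltn_pmod n (ltn0Sn d); rewrite -/j => h1 h2.
  have : (d.+1 <= d.+1 * j)%N by rewrite leq_pmulr.
  move: h1 h2; set e := d.+1; lia.
have jn : (j * d.+1 <= n)%N by apply: leq_trunc_div.
have H k : k%:R * h <= (1 + h) ^+ k.
  elim: k => [|k IHk]; first by rewrite mul0r expr0.
  rewrite exprSr -natr1; have : 1 <= (1 + h) ^+ k.
    by apply: exprn_ege1; rewrite lerDl ltW.
  have : 0 <= h * ((1 + h) ^+ k - 1); last by nra.
  by rewrite mulr_ge0 ?(ltW h0)// subr_ge0 exprn_ege1// lerDl ltW.
have big : (j%:R * h) ^+ d.+1 <= (1 + h) ^+ n.
  apply: (@le_trans _ _ ((1 + h) ^+ (j * d.+1))); last first.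
    by rewrite ler_weXn2l// lerDl ltW.
  rewrite exprM; apply: lerXn2r; rewrite ?nnegrE ?H//.
    by rewrite mulr_ge0 ?(ltW h0).
  by rewrite exprn_ge0// addr_ge0 ?(ltW h0).
have : (r * (1 + h)) ^+ n <= 1 by apply: exprn_ile1; rewrite /h; nra.
rewrite exprMn; apply: le_trans; rewrite mulrC ler_wpM2l ?exprn_ge0//.
apply: le_trans big.
apply: (@le_trans _ _ (C * (2 * d.+1%:R * j%:R) ^+ d)).
  rewrite ler_wpM2l//; apply: lerXn2r; rewrite ?nnegrE ?mulr_ge0//.
  by rewrite -!natrM ler_nat.
have -> : C * (2 * d.+1%:R * j%:R) ^+ d = K * j%:R ^+ d * h ^+ d.+1.
  by rewrite exprMn /K mulrAC mulrA divfK ?mulrA// expf_neq0// gt_eqF.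
rewrite exprMn ler_wpM2r ?exprn_ge0 ?(ltW h0)//.
by rewrite exprS ler_wpM2r ?exprn_ge0.
Qed.

(** Here [x] is D/50 and [300 * x] is m + 1 = 6D, so the factor 1 - 3D/(m+1) is 1/2. *)
Lemma saved_rate (F : realFieldType) (x P t : F) : 0 < x ->
    33 / 200 * (50 * x) ^+ 2 <= P -> t <= 2 * x ->
  2 * (5 / 8640) <=
    (P - 2 * (50 * x) * t) * (1 - 3 * (50 * x) / (300 * x)) / (300 * x) ^+ 2.
Proof.
move=> x0 sp tx; have -> : 3 * (50 * x) / (300 * x) = 1 / 2.
  by field; rewrite gt_eqF.
have x2 : 0 < (300 * x) ^+ 2 by rewrite exprn_gt0// mulr_gt0.
rewrite ler_pdivlMr//.
have : x * t <= x * (2 * x) by rewrite ler_wpM2l// ltW.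
by move: sp; rewrite !expr2; lra.
Qed.

Lemma touch_rate (F : realFieldType) (x : F) : 0 < x ->
  100 * x * (300 * x)^-1 <= 1 / 3.
Proof.
move=> x0; have -> : 100 * x * (300 * x)^-1 = 1 / 3 by field; rewrite gt_eqF.
by [].
Qed.

Lemma touch_tail_rate (F : realFieldType) (a : F) u n :
  a <= 3 / 2 -> 0 <= a -> (n <= u)%N -> (a ^+ 3 / 2 ^+ 2) ^+ u <= (125 / 128) ^+ n.
Proof.
move=> ha a0 nu; have a3 : a ^+ 3 <= (3 / 2) ^+ 3.
  by apply: lerXn2r => //; rewrite nnegrE; lra.
have r0 : 0 <= a ^+ 3 by apply: exprn_ge0.
have r1 : a ^+ 3 / 2 ^+ 2 <= 125 / 128 by lra.
apply: (@le_trans _ _ ((125 / 128) ^+ u)).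
  by apply: lerXn2r => //; rewrite nnegrE; lra.
by apply: ler_wiXn2l => //; lra.
Qed.

(** The base of the numerator is 1 - 1/8640, so each block of [N] colours at least halves it; there
    are 6 x 1440 = 8640 colours per unit of [n]. *)
Lemma saved_tail_rate (F : realFieldType) N n : 8640 <= N%:R :> F ->
  (1 - (1 - 4 / 5) * (5 / 8640)) ^+ (N * n) / (4 / 5) ^+ (3 * n) <=
    (125 / 128) ^+ n :> F.
Proof.
move=> N8640; rewrite (exprM _ N n) (exprM _ 3 n) -expr_div_n.
have := @expr1B_le F ((1 - 4 / 5) * (5 / 8640)) N.
have : 0 <= (1 - (1 - 4 / 5) * (5 / 8640)) ^+ N :> F.
  by apply: exprn_ge0; lra.
set c := _ ^+ N => c0 h.
have {}h : c <= 1 / 2 by apply: h; lra.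
by apply: lerXn2r; rewrite ?nnegrE; lra.
Qed.

(** The left side is 4pd in the local lemma, for failure probability 2r and D^4 dependencies. *)
Lemma sparse_union_bound (F : realFieldType) (r : F) n : let D := (50 * (1440 * n))%N in
  4 * (2 * r) * ((D * D) * (D * D))%:R = 8 * (50 * 1440) ^+ 4 * n%:R ^+ 4 * r.
Proof. by move=> D; rewrite !natrM; ring. Qed.

(* The threshold 2u = D / 25 leaves (33/200 - 2/25) D^2 = 17/200 D^2 untouched
   pairs, and 17/200 / 144 >= 5/8640; the base 4/5 of the exponential moment makes
   (5/4)^3 / 2 = 125/128. *)
Lemma sparse_savings_tail (V : finType) (nb : rel V) (n m : nat) (v : V) :
    let u := (1440 * n)%N in let D := (50 * u)%N in
    reflexive nb -> symmetric nb -> (0 < n)%N -> m.+1 = (6 * D)%N ->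
    (forall x, #|[set y | nb x y]| <= D)%N ->
    33 / 200 * D%:R ^+ 2 <=
      #|[set p | [&& nb v p.1, nb v p.2 & ~~ nb p.1 p.2]]|%:R :> rat ->
  avg (fun w : {ffun V * 'I_(6 * u) -> 'I_m.+1} =>
    (savings nb w v < 3 * n)%N%:R) <= 2 * (125 / 128) ^+ n.
Proof.
move=> u D nbxx nbC n0 mE degD sparse.
have u0 : (0 < u)%N by rewrite muln_gt0.
have uR : (0 : rat) < u%:R by rewrite ltr0n.
have DR : D%:R = 50 * u%:R :> rat by rewrite natrM.
have MR : m.+1%:R = 300 * u%:R :> rat by rewrite mE natrM DR mulrA -natrM.
have tail := @savings_tail V nb (6 * u) m nbxx v (2 * u) D (3 * n)
  (4 / 5) (5 / 8640) ltac:(lra) ltac:(lra) (degD v).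
apply: le_trans (tail _) _ => {tail}.
  move=> w a Tw; rewrite -(ler_pM2l (_ : 0 < 2)); last by lra.
  apply: le_trans (saved_prob (D := D) nbxx nbC w a _ degD (leqnn _)); last first.
    by rewrite mE leq_mul2r orbT.
  set P : rat := _%:R in sparse *.
  have TR : (tcount nb w v a)%:R <= 2 * u%:R :> rat by rewrite -natrM ler_nat.
  rewrite DR in sparse; rewrite DR MR.
  exact: saved_rate uR sparse TR.
have -> : 2 * (125 / 128) ^+ n = (125 / 128) ^+ n + (125 / 128) ^+ n :> rat by ring.
apply: lerD.
  (* The exponent is cut into 3u blocks of 100u factors; each block contributes at most 3/2, against
     2^(2u). *)
  have -> : (D * (6 * u) = 100 * u * 3 * u)%N by rewrite /D; ring.
  rewrite (exprM _ (100 * u * 3) u) (exprM _ (100 * u) 3) (exprM _ 2 u) -expr_div_n.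
  have h : (1 + m.+1%:R^-1) ^+ (100 * u) <= 3 / 2 :> rat.
    apply: expr1D_le; first by rewrite invr_ge0.
    by rewrite MR natrM touch_rate.
  have q0 : 0 <= (1 + m.+1%:R^-1) ^+ (100 * u) :> rat.
    by apply: exprn_ge0; apply: addr_ge0; [exact: ler01 | rewrite invr_ge0 ler0n].
  have nu : (n <= u)%N by rewrite leq_pmull.
  exact: touch_tail_rate h q0 nu.
rewrite /u mulnA; apply: saved_tail_rate.
by rewrite natrM; lra.
Qed.

(** Only neighbourhoods of more than D - 3n vertices need savings, and 3n suffice. A failure depends
    on coordinates within distance 2, so two failures interact only within distance 4: hence D^4
    dependencies. *)
Lemma sparse_colouring : exists n0 : nat, forall n, (n0 <= n)%N ->
  let D := (50 * (1440 * n))%N in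
  forall (V : finType) (nb : rel V), reflexive nb -> symmetric nb ->
    (forall v, #|[set u | nb v u]| <= D)%N ->
    (forall v, (D - 3 * n < #|[set u | nb v u]|)%N -> 33 / 200 * D%:R ^+ 2 <=
      #|[set p | [&& nb v p.1, nb v p.2 & ~~ nb p.1 p.2]]|%:R :> rat) ->
  exists c : V -> 'I_(D - 3 * n), forall u v, nb u v -> u != v -> c u != c v.
Proof.
have [n0 n0P] := @poly_geometric (8 * (50 * 1440) ^+ 4) (125 / 128) 4
  ltac:(lra) ltac:(lra).
exists n0.+1 => n nn D V nb nbxx nbC degD sparse.
have n_gt0 : (0 < n)%N by apply: leq_trans nn.
have D_gt0 : (0 < D)%N by rewrite !muln_gt0.
have [m mE] : exists m, m.+1 = (6 * D)%N.
  by exists (6 * D).-1; rewrite prednK// muln_gt0.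
pose k := (6 * (1440 * n))%N.
pose N v := [set u | nb v u].
pose B v := \bigcup_(x in N v) N x.
have BC x y : (x \in B y) = (y \in B x).
  apply/bigcupP/bigcupP=> -[z]; rewrite !inE => h1 h2; exists z;
    by rewrite inE nbC.
have cB v : (#|B v| <= D * D)%N.
  by apply: leq_trans (card_bigcup_le _ degD) _; rewrite leq_mul2r degD orbT.
pose bad v (w : {ffun V * 'I_k -> 'I_m.+1}) :=
  (D - 3 * n < #|N v|)%N && (savings nb w v < 3 * n)%N.
have p_ge0 : 0 <= 2 * (125 / 128) ^+ n :> rat.
  by apply: mulr_ge0; [lra | apply: exprn_ge0; lra].
pose dom v : {set V * 'I_k} := [set i | i.1 \in B v].
have := @local_lemma V _ m ((D * D) * (D * D)) (2 * (125 / 128) ^+ n) bad dom.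
case.
- move=> v w w' ww'; rewrite /bad; congr (_ && (_ < _)%N).
  apply: eq_card => a; rewrite !inE; apply: (saved_ext nbxx) => b x y vx xy _.
  by rewrite /hit ww'// inE; apply/bigcupP; exists x; rewrite inE.
- move=> v; rewrite /bad; case: (boolP (D - 3 * n < #|N v|)%N) => [vN|_] /=.
    exact: sparse_savings_tail nbxx nbC n_gt0 mE degD (sparse v vN).
  by rewrite avg_cst; [exact: p_ge0 | exact: card_space_gt0].
- move=> v; apply: (@leq_trans #|\bigcup_(y in B v) B y|).
    apply: subset_leq_card; apply/subsetP=> u; rewrite inE.
    case/pred0Pn=> -[y a]; rewrite /= !inE /= => /andP[uy vy].
    by apply/bigcupP; exists y; rewrite // BC.
  by apply: leq_trans (card_bigcup_le _ cB) _; rewrite leq_mul2r cB orbT.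
- have := n0P n (ltnW nn); apply: le_trans; rewrite le_eqVlt; apply/orP; left.
  by rewrite /D; apply/eqP/sparse_union_bound.
- exact: p_ge0.
- by rewrite !muln_gt0 n_gt0.
move=> w wP; apply: (savings_colouring (w := w) nbxx nbC _ degD).
  by rewrite /k /D; lia.
move=> v vN; have := wP v; rewrite /bad vN /= -leqNgt.
by rewrite /D; lia.
Qed.

(** * Walks and the distance between edges *)

Section Walks.
Variable G : sgraph.
Implicit Types (x y z u : G) (A B : {set G}).
Notation d := (max_degree G).

Lemma degree_le x : (degree x <= d)%N.
Proof. exact: leq_bigmax. Qed.

Fixpoint walks (k : nat) x z : nat :=
  (if k is k'.+1 then \sum_(y | adj x y) walks k' y z else (x == z))%N.

Lemma walksSr k x z : walks k.+1 x z = (\sum_(y | adj z y) walks k x y)%N.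
Proof.
elim: k x => [|k IHk] x.
  rewrite /= (big_mkcond (adj x)) (bigD1 z)//= eqxx big1 => [|y /negbTE->]; last first.
    by case: ifP.
  rewrite big_mkcond (bigD1 x)//= eqxx big1 => [|y /negbTE yx]; last first.
    by rewrite eq_sym yx; case: ifP.
  by rewrite adj_sym.
rewrite [LHS]/=; under eq_bigr do rewrite -/(walks k.+1 _ _) IHk.
by rewrite exchange_big.
Qed.

Lemma walksC k x z : walks k x z = walks k z x.
Proof.
elim: k x z => [|k IHk] x z; first by rewrite /= eq_sym.
by rewrite walksSr; apply: eq_bigr => y _; rewrite IHk.
Qed.

Lemma walks_sum k x : (\sum_z walks k x z <= d ^ k)%N.
Proof.
elim: k x => [|k IHk] x.
  by rewrite (bigD1 x)//= eqxx big1 // => z /negbTE; rewrite eq_sym => ->.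
rewrite /= exchange_big /= expnS; apply: (@leq_trans (\sum_(y | adj x y) d ^ k)).
  by apply: leq_sum => y _.
rewrite sum_nat_const leq_mul2r; apply/orP; right.
by apply: leq_trans (degree_le x); rewrite /degree cardsE.
Qed.

Definition reach k x := [set z | 0 < walks k x z]%N.

Lemma card_reach k x : (#|reach k x| <= d ^ k)%N.
Proof.
apply: leq_trans (walks_sum k x); rewrite -sum1_card big_mkcond.
by apply: leq_sum => z _; rewrite inE; case: ifP.
Qed.

(** Exactly [k] steps are asked for; between edges this includes fewer steps, by going back and
    forth along an edge. *)
Definition near k A B := [exists x in A, exists z in B, z \in reach k x].

Lemma nearP k A B :
  reflect (exists x z, [/\ x \in A, z \in B & 0 < walks k x z]%N) (near k A B).
Proof.
apply: (iffP existsP) => [[x /andP[xA /existsP[z /andP[zB]]]]|[x [z [xA zB xz]]]].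
  by rewrite inE => xz; exists x, z.
by exists x; rewrite xA; apply/existsP; exists z; rewrite zB inE.
Qed.

Lemma nearC k A B : near k A B = near k B A.
Proof.
by apply/nearP/nearP => -[x [z [? ? ?]]]; exists z, x; rewrite walksC.
Qed.

Lemma edgesP A :
  reflect (exists x y, adj x y /\ A = [set x; y]) (A \in edges G).
Proof.
rewrite inE; apply: (iffP existsP) => [[x /existsP[y /andP[xy /eqP->]]]|].
  by exists x, y.
by move=> [x [y [xy ->]]]; exists x; apply/existsP; exists y; rewrite xy eqxx.
Qed.

Lemma edge_at A z : A \in edges G -> z \in A ->
  exists2 y, adj z y & A = [set z; y].
Proof.
move=> /edgesP[x [y [xy ->]]]; rewrite !inE => /orP[] /eqP->; first by exists y.
by exists x; rewrite 1?adj_sym// setUC.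
Qed.

Lemma card_edge A : A \in edges G -> #|A| = 2%N.
Proof.
move=> /edgesP[x [y [xy ->]]]; rewrite cards2.
by have [E|] := eqVneq x y; first by rewrite E adj_irr in xy.
Qed.

(* A walk from one end of an edge A is prolonged by a first step along A. *)
Lemma nearS k A B : A \in edges G -> near k A B -> near k.+1 A B.
Proof.
move=> AE /nearP[x [z [xA zB xz]]]; have [y xy E] := edge_at AE xA.
apply/nearP; exists y, z; split=> //; first by rewrite E !inE eqxx orbT.
by rewrite /= (bigD1 x) 1?adj_sym//= addn_gt0 xz.
Qed.

Lemma near_leq j k A B : A \in edges G -> (j <= k)%N -> near j A B -> near k A B.
Proof.
move=> AE /subnK <-; elim: (k - j)%N => // i IHi /IHi; exact: nearS.
Qed.

Lemma near_refl k A : A \in edges G -> near k A A.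
Proof.
move=> AE; apply: (near_leq AE (leq0n k)); have /edgesP[x [y [_ ->]]] := AE.
by apply/nearP; exists x, x; rewrite /= eqxx !inE eqxx.
Qed.

Lemma path_walks x s : path (@adj G) x s -> (0 < walks (size s) x (last x s))%N.
Proof.
elim: s x => [|y s IHs] x /=; first by rewrite eqxx.
by move=> /andP[xy /IHs ys]; rewrite (bigD1 y)//= addn_gt0 ys.
Qed.

(** Distance counts vertices: a path with m <= t vertices has m - 1 <= t - 1 steps. *)
Lemma edge_dist_near t (A B : edge G) :
  edge_dist_le t A B -> near t.-1 (val A) (val B).
Proof.
rewrite /edge_dist_le /edge_dist.
case E: [seq m <- _ | _] => [|m s] //= mt.
have := mem_head m s; rewrite -E.
rewrite mem_filter => /andP[/existsP[[q /= /eqP qm]]].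
case: q qm => // x q qm /and4P[xA pq _ lB] _.
apply: (@near_leq (size q)); first exact: valP.
  by rewrite -ltnS prednK -?qm //; move: mt; rewrite -qm /=; case: (t).
by apply/nearP; exists x, (last x q); split=> //; apply: path_walks.
Qed.

(** The other end of such an edge is a neighbour of [z] outside [T], and determines the edge. *)
Lemma card_edges_at z (N : {set {set G}}) (T : {set G}) : N \subset edges G ->
    (forall g, g \in N -> z \in g -> [disjoint g & T]) ->
  (#|[set g in N | z \in g]| + #|[set y | adj z y && (y \in T)]| <= d)%N.
Proof.
move=> NE NT; apply: leq_trans (degree_le z); rewrite /degree.
rewrite -[X in (_ <= X)%N](cardsID T) addnC leq_add//.
  by apply: subset_leq_card; apply/subsetP=> y; rewrite !inE.
apply: (@leq_trans #|[set [set z; y] | y in [set y | adj z y] :\: T]|); last first.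
  exact: leq_imset_card.
apply: subset_leq_card; apply/subsetP=> g; rewrite !inE => /andP[gN zg].
have [y zy gE] := edge_at (subsetP NE _ gN) zg.
apply/imsetP; exists y => //; rewrite !inE zy andbT.
have /pred0P/(_ y) := NT g gN zg.
by rewrite /= gE !inE eqxx orbT /= => ->.
Qed.

Lemma card_meeting (N : {set {set G}}) (T : {set G}) : N \subset edges G ->
  (#|[set g in N | ~~ [disjoint g & T]]| <= d * #|T|)%N.
Proof.
move=> NE.
apply: (@leq_trans #|\bigcup_(z in T) [set g in N | z \in g]|).
  apply: subset_leq_card; apply/subsetP=> g; rewrite inE => /andP[gN].
  case/pred0Pn=> z /andP[/= zg zT]; apply/bigcupP; exists z => //.
  by rewrite inE gN.
rewrite mulnC; apply: card_bigcup_le => z.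
apply: leq_trans (leq_addr _ _) (card_edges_at (T := set0) NE _) => g _ _.
by apply/pred0P=> y; rewrite /= inE andbF.
Qed.

(** * Near pairs of edges around a vertex *)

Section Spread.
Variables (k : nat) (u : G) (N : {set {set G}}).
Hypotheses (NE : N \subset edges G) (N_le : (#|N| <= 2 * d ^ k.+1)%N).

Let T := reach k u.
Let far := [set g in N | [disjoint g & T]].
Let K z := #|[set g in far | z \in g]|.
Let degT z := #|[set y | adj z y && (y \in T)]|.
(** Excess multiplicity of the walks to the neighbours of [z]; its total is charged to d^(k+1) -
    d|T|. *)
Let err z := (\sum_(y | adj z y) (walks k u y).-1)%N.

Let farE : far \subset edges G.
Proof. by apply: subset_trans NE; apply/subsetP=> g; rewrite inE => /andP[]. Qed.

Let walks_err z : walks k.+1 u z = (degT z + err z)%N.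
Proof.
rewrite walksSr /degT -sum1_card /err.
under [X in (X + _)%N]eq_bigl do rewrite inE.
rewrite big_mkcondr -big_split /=; apply: eq_bigr => y _.
by rewrite inE; case: (walks k u y).
Qed.

Let K_degT z : (K z + degT z <= d)%N.
Proof.
by apply: card_edges_at => // g; rewrite inE => /andP[].
Qed.

Let sum_K : (\sum_z K z = 2 * #|far|)%N.
Proof.
rewrite /K; under eq_bigr do rewrite -sum1_card big_mkcond.
rewrite exchange_big /= mulnC -sum_nat_const [RHS]big_mkcond; apply: eq_bigr => g _.
under eq_bigr do rewrite inE.
case: ifP => [gf|_]; last by rewrite big1.
rewrite -(card_edge (subsetP farE _ gf)) -sum1_card [RHS]big_mkcond.
by apply: eq_bigr.
Qed.

Let sum_degT : (\sum_z degT z <= d * #|T|)%N.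
Proof.
rewrite /degT; under eq_bigr do rewrite -sum1_card big_mkcond.
rewrite exchange_big /= mulnC -sum_nat_const [X in (_ <= X)%N]big_mkcond.
apply: leq_sum => y _; under eq_bigr do rewrite inE.
case: ifP => [yT|_]; last by rewrite big1 // => z _; rewrite andbF.
apply: leq_trans (degree_le y); rewrite /degree -sum1_card big_mkcond.
rewrite [X in (_ <= X)%N]big_mkcond; apply: leq_sum => z _.
by rewrite !inE adj_sym andbT.
Qed.

Let sum_err : (\sum_z err z + d * #|T| <= d ^ k.+1)%N.
Proof.
apply: (@leq_trans (d * \sum_y walks k u y)); last first.
  by rewrite expnS leq_mul2l walks_sum orbT.
have -> : (\sum_y walks k u y = \sum_y (walks k u y).-1 + #|T|)%N.
  rewrite -sum1_card [X in (_ + X)%N]big_mkcond -big_split; apply: eq_bigr => y _.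
  by rewrite inE; case: (walks k u y) => //= j; rewrite addn1.
rewrite mulnDr leq_add2r /err (exchange_big_dep predT) //= big_distrr /=.
apply: leq_sum => y _; rewrite sum_nat_const leq_mul2r; apply/orP; right.
apply: leq_trans (degree_le y); rewrite /degree; apply/eq_leq/eq_card => z.
by rewrite !inE adj_sym.
Qed.

(* The constant 5/3, to be compared with the trivial bound 2, comes from
   9ab <= (a + b)(a + 4b) for a = K z and b = degT z. *)
Lemma near_pairs_at :
  (3 * \sum_(w | adj u w) #|[set g in N | near k [set u; w] g]| <= 5 * d ^ k.+2)%N.
Proof.
pose E := [set g in N | ~~ [disjoint g & T]].
have cE : (#|E| <= d * #|T|)%N by apply: card_meeting.
have cN : (#|E| + #|far| <= 2 * d ^ k.+1)%N.
  apply: leq_trans N_le; rewrite -(cardsID E N) leq_add//.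
    by apply: subset_leq_card; apply/subsetP=> g; rewrite !inE => /andP[-> ->].
  by apply: subset_leq_card; apply/subsetP=> g; rewrite !inE => /andP[-> ->].
(* An edge avoiding [T] is not reached from [u] in [k] steps, so it must be reached from [w]. *)
have count w : adj u w -> (#|[set g in N | near k [set u; w] g]| <=
    #|E| + \sum_z K z * (0 < walks k w z))%N.
  move=> uw; pose F := \bigcup_(z in reach k w) [set g in far | z \in g].
  apply: (@leq_trans (#|E :|: F|)).
    apply: subset_leq_card; apply/subsetP=> g; rewrite 3!inE => /andP[gN].
    rewrite gN /=; case: (boolP [disjoint g & T]) => //= dgT.
    case/nearP=> x [z [xuw zg xz]]; apply/bigcupP; exists z.
      move: xuw; rewrite !inE => /orP[/eqP E1|/eqP <-//].
      move/pred0P: dgT => /(_ z); rewrite /= zg inE /= => /negbT.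
      by rewrite -E1 xz.
    by rewrite !inE gN dgT.
  rewrite (leq_trans (leq_card_setU _ _))// leq_add2l /F.
  rewrite (leq_trans (card_bigcup_sum _ _))// [X in (X <= _)%N]big_mkcond.
  by apply: leq_sum => z _; rewrite inE; case: (0 < _)%N; rewrite ?muln1.
have K_err z : (9 * (K z * walks k.+1 u z) <= d * (K z + 4 * degT z + 9 * err z))%N.
  rewrite walks_err; have := K_degT z.
  move: (K z) (degT z) (err z) => a b c; move: d => e h.
  have h1 : (a * c <= e * c)%N by rewrite leq_mul2r (leq_trans (leq_addr b a) h) orbT.
  have h2 : ((a + b) * (a + 4 * b) <= e * (a + 4 * b))%N by rewrite leq_mul2r h orbT.
  have h3 : (4 * (a * b) <= a * a + 4 * (b * b))%N
    by have [h3 _] := nat_Cauchy a (2 * b); rewrite -!mulnn in h3; lia.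
  lia.
have A_le : (\sum_(w | adj u w) #|[set g in N | near k [set u; w] g]| <=
    d * #|E| + \sum_z K z * walks k.+1 u z)%N.
  apply: (@leq_trans (\sum_(w | adj u w) (#|E| + \sum_z K z * (0 < walks k w z))%N)).
    exact: leq_sum.
  rewrite big_split /= leq_add//.
    rewrite sum_nat_const leq_mul2r; apply/orP; right.
    by apply: leq_trans (degree_le u); rewrite /degree cardsE.
  rewrite exchange_big /=; apply: leq_sum => z _.
  rewrite -big_distrr leq_mul2l /=; apply/orP; right.
  by apply: leq_sum => w _; case: (walks k w z).
have B_le : (9 * \sum_z K z * walks k.+1 u z <=
    d * (2 * #|far| + 4 * (\sum_z degT z) + 9 * (\sum_z err z)))%N.
  rewrite -sum_K [X in (X <= _)%N]big_distrr /=.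
  apply: (@leq_trans (\sum_z (d * (K z + 4 * degT z + 9 * err z)))%N).
    exact: leq_sum.
  rewrite [X in (_ <= _ * (_ + X + _))%N]big_distrr.
  by rewrite [X in (_ <= _ * (_ + X))%N]big_distrr -!big_split big_distrr.
have [sd se] := (sum_degT, sum_err).
rewrite expnS; move: A_le B_le sd se cN cE.
set A := (\sum_(w | _) _)%N; set B := (\sum_z K z * _)%N.
set X := (\sum_z degT z)%N; set Y := (\sum_z err z)%N.
move: (d ^ k.+1)%N (d * #|T|)%N #|E| #|far| => D t e f.
move: d => q h1 h2 h3 h4 h5 h6.
(* The sum is 7e + 2(e + f) + 4X + 9Y <= 7t + 4D + 4t + 9(D - t) = 13D + 2t <= 15D. *)
have : (q * (9 * e + (2 * f + 4 * X + 9 * Y)) <= q * (15 * D))%N.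
  by rewrite leq_mul2l; apply/orP; right; lia.
rewrite mulnDr; lia.
Qed.

End Spread.

Lemma card_near (k : nat) (e : {set G}) : e \in edges G ->
  (#|[set g in edges G | near k e g]| <= 2 * d ^ k.+1)%N.
Proof.
move=> eE; pose S := \bigcup_(x in e) reach k x.
have cS : (#|S| <= 2 * d ^ k)%N.
  by apply: leq_trans (card_bigcup_le _ (card_reach k)) _; rewrite (card_edge eE).
apply: (@leq_trans #|[set g in edges G | ~~ [disjoint g & S]]|).
  apply: subset_leq_card; apply/subsetP=> g; rewrite !inE => /andP[-> /=].
  case/nearP=> x [z [xe zg xz]]; apply/pred0Pn; exists z; rewrite /= zg.
  by apply/bigcupP; exists x; rewrite // inE.
apply: leq_trans (card_meeting _ (subxx _)) _.
by rewrite expnS mulnCA leq_mul2l cS orbT.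
Qed.

(** Every [f] in [N] has an end [u] in [S], so [near_pairs_at] is summed over at most 2d^k vertices.
    For D = 2d^(k+1) the bound reads 5/6 D^2. *)
Lemma near_pairs (k : nat) (e : {set G}) (N : {set {set G}}) :
    e \in edges G -> N = [set g in edges G | near k e g] ->
  (3 * \sum_(f in N) #|[set g in N | near k f g]| <= 10 * d ^ k.+1 * d ^ k.+1)%N.
Proof.
move=> eE Ndef; pose S := \bigcup_(x in e) reach k x.
have cS : (#|S| <= 2 * d ^ k)%N.
  by apply: leq_trans (card_bigcup_le _ (card_reach k)) _; rewrite (card_edge eE).
have NE : N \subset edges G by rewrite Ndef; apply/subsetP=> g; rewrite inE => /andP[].
pose h f := #|[set g in N | near k f g]|.
apply: (@leq_trans (3 * \sum_(u in S) \sum_(w | adj u w) h [set u; w])).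
  rewrite leq_mul2l /=.
  apply: (@leq_trans (\sum_(f in N) \sum_(u in S)
      \sum_(w | adj u w && ([set u; w] == f)) h f)%N).
    apply: leq_sum => f fN; move: (fN); rewrite {1}Ndef inE => /andP[fE].
    case/nearP=> x [z [xe zf xz]].
    have [y zy fzy] := edge_at fE zf.
    rewrite (bigD1 z) /=; last by apply/bigcupP; exists x; rewrite // inE.
    rewrite (bigD1 y) /=; last by rewrite zy -fzy eqxx.
    by rewrite -addnA leq_addr.
  rewrite exchange_big /=; apply: leq_sum => u _.
  under eq_bigr do rewrite big_mkcondr /=.
  rewrite exchange_big /=; apply: leq_sum => w _.
  rewrite -big_mkcondr /=; apply: (@leq_trans (\sum_(f | f == [set u; w]) h f)%N).
    rewrite big_mkcond [X in (_ <= X)%N]big_mkcond; apply: leq_sum => f _.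
    by rewrite eq_sym; case: (f \in N) => /=; case: (f == _).
  by rewrite big_pred1_eq.
rewrite big_distrr /=; apply: (@leq_trans (\sum_(u in S) 5 * d ^ k.+2)%N).
  by apply: leq_sum => u _; apply: near_pairs_at => //; rewrite Ndef card_near.
rewrite sum_nat_const; apply: (@leq_trans (2 * d ^ k * (5 * d ^ k.+2))).
  by rewrite leq_mul2r cS orbT.
rewrite !expnS; apply: eq_leq; ring.
Qed.

End Walks.

(** * The graph of near edges *)

Section NearGraph.
Variables (G : sgraph) (k : nat).
Notation d := (max_degree G).

Definition near_edges : rel (edge G) := fun A B => near k (val A) (val B).

Lemma near_edges_refl : reflexive near_edges.
Proof. by move=> A; apply: near_refl; apply: valP. Qed.

Lemma near_edges_sym : symmetric near_edges.
Proof. by move=> A B; apply: nearC. Qed.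

Lemma card_near_edges A :
  (#|[set B | near_edges A B]| <= 2 * d ^ k.+1)%N.
Proof.
apply: leq_trans (card_near k (valP A)); rewrite -(card_imset _ val_inj).
apply: subset_leq_card; apply/subsetP=> g /imsetP[B]; rewrite inE => AB ->.
by rewrite inE (valP B).
Qed.

Lemma card_near_edges_pairs A :
  (3 * #|[set p | [&& near_edges A p.1, near_edges A p.2 & near_edges p.1 p.2]]|
    <= 10 * d ^ k.+1 * d ^ k.+1)%N.
Proof.
apply: leq_trans (near_pairs (valP A) erefl); rewrite leq_mul2l /=.
set N := [set g in edges G | near k (val A) g].
have NE D : near_edges A D -> val D \in N by move=> AD; rewrite inE (valP D).
rewrite (eq_bigr (fun f => \sum_(g | (g \in N) && near k f g) 1)%N); last first.
  by move=> f _; rewrite sum1dep_card.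
rewrite pair_big_dep /= sum1dep_card.
pose v2 (p : edge G * edge G) := (val p.1, val p.2).
have v2_inj : injective v2 by move=> [B C] [B' C'] [/val_inj-> /val_inj->].
rewrite -(card_imset _ v2_inj); apply: subset_leq_card.
apply/subsetP=> q /imsetP[[B C]]; rewrite inE /= => /and3P[AB AC BC] ->.
by rewrite inE /= (NE B AB) (NE C AC).
Qed.

Lemma chromatic_index_le q (c : edge G -> 'I_q) :
    (forall A B, near_edges A B -> A != B -> c A != c B) ->
  (chromatic_index G k.+1 <= q)%N.
Proof.
move=> c_proper; rewrite /chromatic_index; case: ex_minnP => m _; apply.
apply/existsP; exists [ffun A => c A]; apply/forallP=> A; apply/forallP=> B.
apply/implyP=> /andP[AB dAB]; rewrite !ffunE; apply: c_proper => //.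
exact: edge_dist_near dAB.
Qed.

End NearGraph.

(** * Choice of the constants and conclusion *)

Lemma dense_nonadjacent (F : realFieldType) (x N P Q Y : F) :
    0 <= x -> 0 <= Y -> 2 * Y <= 50 * (1440 * x) -> 50 * (1440 * x) - 3 * x <= N -> N * N = P + Q ->
    3 * P <= 10 * Y * Y ->
  33 / 200 * (50 * (1440 * x)) ^+ 2 <= Q.
Proof.
move=> x0 Y0 hY hN hNN hP.
have h1 : (50 * (1440 * x) - 3 * x) * (50 * (1440 * x) - 3 * x) <= N * N by apply: ler_pM => //; lra.
have h2 : (2 * Y) * (2 * Y) <= (50 * (1440 * x)) * (50 * (1440 * x)) by apply: ler_pM => //; lra.
have h3 : 0 <= x * x by apply: mulr_ge0.
(* With D = 72000x, Q >= ((1 - 1/24000)^2 - 5/6) D^2, and the bracket exceeds 33/200. *)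
rewrite expr2; lra.
Qed.

(** Saving 3x out of 72000x turns 2Y into (2 - 1/12000)Y. As 1/12000 > 8/10^5, the gap absorbs the
    rounding error 72000 once Y >= 10^11. *)
Lemma colour_count (F : realFieldType) (x Y : F) :
    50 * (1440 * x) <= 2 * Y + 50 * 1440 -> 10 ^+ 11 <= Y ->
  50 * (1440 * x) - 3 * x <= (2 - 8 / 10 ^+ 5) * Y.
Proof. by move=> h1 h2; lra. Qed.

Lemma round_up (m D : nat) : (0 < m)%N -> exists n, (D <= m * n <= D + m)%N.
Proof.
move=> m0; exists (D %/ m).+1; have := divn_eq D m; have := ltn_pmod D m0.
by rewrite mulnS [(m * _)%N]mulnC; lia.
Qed.

Theorem theorem1 (t : nat) (ht : (2 <= t)%N) :
  exists Delta0 : nat, forall G : sgraph,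
    (Delta0 <= max_degree G)%N ->
    ((chromatic_index G t)%:R : rat)
      <= (2 - 8 / 10 ^+ 5) * (max_degree G)%:R ^+ t.
Proof.
(* [k] = t - 1 is the number of steps of a walk with t vertices. *)
case: t ht => // k _; have [n0 colouring] := sparse_colouring.
have [X XP] : exists X : nat, forall Y : rat, X%:R <= Y -> 10 ^+ 11 <= Y.
  exists (Num.bound (10 ^+ 11 : rat)) => Y; apply: le_trans.
  by apply: ltW; apply: archi_boundP; apply: exprn_ge0; apply: ler0n.
(* The first summand makes d^t at least 10^11, the second makes [n] at least [n0]. *)
exists (X + 50 * (1440 * n0))%N => G; set d := max_degree G => dP.
have d_le : (d <= d ^ k.+1)%N.
  case: d {dP} => [|e]; first exact: leq0n.
  by rewrite -[leqLHS]expn1 leq_pexp2l.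
(* 2d^t is rounded up to a multiple of 72000, the form that [sparse_colouring] asks for. *)
have [n /andP[Dn nD]] := @round_up (50 * 1440) (2 * d ^ k.+1) isT.
have n0n : (n0 <= n)%N.
  have : (50 * 1440 * n0 <= 50 * 1440 * n)%N.
    by apply: leq_trans Dn; move: dP d_le; move: (d ^ k.+1)%N; lia.
  by rewrite leq_pmul2l.
rewrite -mulnA in Dn nD.
have := colouring n n0n _ (near_edges (G := G) k) (@near_edges_refl G k)
  (@near_edges_sym G k).
have DE : (50 * (1440 * n))%:R = 50 * (1440 * n%:R) :> rat.
  by rewrite !natrM.
case.
- by move=> A; apply: leq_trans (card_near_edges k A) Dn.
- move=> A AN; rewrite DE.
  set N := [set B | near_edges k A B] in AN.
  pose P := #|[set p | [&& near_edges k A p.1, near_edges k A p.2 & near_edges k p.1 p.2]]|.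
  apply: (@dense_nonadjacent _ n%:R #|N|%:R P%:R _ (d ^ k.+1)%:R).
  + exact: ler0n.
  + exact: ler0n.
  + by rewrite -DE -natrM ler_nat.
  + rewrite -DE lerBlDr -natrM -natrD ler_nat.
    by move: AN; move: #|N| (50 * _)%N (3 * n)%N; lia.
  + rewrite -natrM -natrD; congr _%:R; rewrite -cardsX /P.
    rewrite -(cardsID [set p | near_edges k p.1 p.2] (setX N N)).
    congr (_ + _)%N; apply: eq_card => -[B C].
      by rewrite in_setI in_setX !in_set andbA.
    by rewrite in_setD in_setX !in_set andbC andbA.
  + by rewrite -!natrM ler_nat card_near_edges_pairs.
move=> c c_proper.
apply: (@le_trans _ _ (50 * (1440 * n) - 3 * n)%:R).
  by rewrite ler_nat; apply: (chromatic_index_le c_proper).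
rewrite natrB; last by lia.
have YE : d%:R ^+ k.+1 = (d ^ k.+1)%:R :> rat by rewrite natrX.
rewrite DE natrM YE; apply: colour_count.
  by move: nD; rewrite -(ler_nat rat) natrD !natrM.
apply: XP; rewrite ler_nat; apply: leq_trans d_le.
by apply: leq_trans dP; apply: leq_addr.
Qed.
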